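(* (Necessary condition for the stability property.) Assume the stability property holds: there exist $C$ and $\delta>0$ such that for any $\overline{L}\in\mathbb{N}$, any $\overline{\mathbf{h}}\in\mathcal{M}^{\overline L}$, any $X=\mathcal{A}P(\overline{\mathbf{h}})+e$ with $\|e\|\leq\delta$, any $L^*\in\mathbb{N}$ and any $\mathbf{h}^*\in\mathcal{M}^{L^*}$ such that $$\|\mathcal{A}P(\mathbf{h}^* )-X\|^2\leq\|e\|,$$ we have $$d_2(\langle\mathbf{h}^*\rangle,\langle\overline{\mathbf{h}}\rangle)\leq C\,\min\left(\|P(\overline{\mathbf{h}})\|_\infty^{\frac1K-1},\|P(\mathbf{h}^* )\|_\infty^{\frac1K-1}\right)\|e\|.$$ Then $\mathrm{Ker}(\mathcal{A})$ satisfies the deep-Null Space Property with respect to the collection of models $\mathcal{M}$ with constants $$(\gamma,\rho)=\left(C\,S^{\frac{K-1}{2}}\sqrt{K}\,\sigma_{max},\ \delta\right),$$ where $\sigma_{max}$ is the largest singular value of $\mathcal{A}$.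
   Context: $K\geq 1$, $S\geq 2$ are integers, $[K]=\{1,\dots,K\}$, $[S]=\{1,\dots,S\}$. An element $\mathbf{h}\in\mathbb{R}^{S\times K}$ is a $K$-tuple of vectors $\mathbf{h}_1,\dots,\mathbf{h}_K\in\mathbb{R}^S$ with entries $\mathbf{h}_{k,i}$. $\mathbb{R}^{S^K}$ is the space of real order-$K$ tensors whose axes are of size $S$. $\|\cdot\|=\|\cdot\|_2$ is the Euclidean norm (Frobenius norm for matrices), $\|\cdot\|_\infty$ the maximum of the absolute values of the entries. $P:\mathbb{R}^{S\times K}\to\mathbb{R}^{S^K}$ is defined by $P(\mathbf{h})_{\mathbf{i}}=\mathbf{h}_{1,i_1}\cdots\mathbf{h}_{K,i_K}$ for $\mathbf{i}=(i_1,\dots,i_K)\in[S]^K$. $M_k:\mathbb{R}^S\to\mathbb{R}^{m_k\times m_{k+1}}$ ($k=1,\dots,K$, $m_1=m$, $m_{K+1}=n$) are linear maps and $\mathcal{A}:\mathbb{R}^{S^K}\to\mathbb{R}^{m\times n}$ is the unique linear map such that $M_1(\mathbf{h}_1)\cdots M_K(\mathbf{h}_K)=\mathcal{A}P(\mathbf{h})$ for all $\mathbf{h}\in\mathbb{R}^{S\times K}$. Here $X,e\in\mathbb{R}^{m\times n}$. $\mathcal{M}=(\mathcal{M}^L)_{L\in\mathbb{N}}$ is a collection of models: each $\mathcal{M}^L$ is a nonempty subset of $\mathbb{R}^{S\times K}$. $P(\mathcal{M}^L)-P(\mathcal{M}^{L'})=\{P(\mathbf{h})-P(\mathbf{g})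 : \mathbf{h}\in\mathcal{M}^L,\ \mathbf{g}\in\mathcal{M}^{L'}\}$. Equivalence classes and metric: on $\mathbb{R}^{S\times K}_*=\{\mathbf{h}\in\mathbb{R}^{S\times K} : \|\mathbf{h}_k\|\neq0\ \forall k\in[K]\}$, $\mathbf{h}\sim\mathbf{g}$ if and only if there are $\lambda_1,\dots,\lambda_K\in\mathbb{R}$ with $\prod_{k=1}^K\lambda_k=1$ and $\mathbf{h}_k=\lambda_k\mathbf{g}_k$ for all $k\in[K]$; $\langle\mathbf{h}\rangle$ is the equivalence class of $\mathbf{h}$. $\mathbb{R}^{S\times K}_{\rm diag}=\{\mathbf{h}\in\mathbb{R}^{S\times K}_* : \|\mathbf{h}_k\|_\infty=\|\mathbf{h}_1\|_\infty\ \forall k\in[K]\}$ and, for $\mathbf{h},\mathbf{g}\in\mathbb{R}^{S\times K}_*$, $d_2(\langle\mathbf{h}\rangle,\langle\mathbf{g}\rangle)=\inf\{\|\mathbf{h}'-\mathbf{g}'\|_2 : \mathbf{h}'\in\langle\mathbf{h}\rangle\cap\mathbb{R}^{S\times K}_{\rm diag},\ \mathbf{g}'\in\langle\mathbf{g}\rangle\cap\mathbb{R}^{S\times K}_{\rm diag}\}$. Deep-Null Space Property: for $\gamma>0$ and $\rho>0$, $\mathrm{Ker}(\mathcal{A})$ satisfies it with respect to $\mathcal{M}$ with constants $(\gamma,\rho)$ if for any $L,L'\in\mathbb{N}$, any $T\in P(\mathcal{M}^L)-P(\mathcal{M}^{L'})$ satisfying $\|\mathcal{A}T\|\leq\rho$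 and any $T'\in\mathrm{Ker}(\mathcal{A})$, one has $\|T\|\leq\gamma\|T-T'\|$. *)

(* Defs.v *)
From HB Require Import structures.
From mathcomp Require Import all_boot all_order all_algebra.
From mathcomp Require Import all_classical all_reals all_analysis.

Set Implicit Arguments.
Unset Strict Implicit.
Unset Printing Implicit Defensive.
Import Order.TTheory GRing.Theory Num.Theory.
Local Open Scope classical_set_scope.
Local Open Scope ring_scope.

(* Conventions: all indices start at 0.  An element h of R^{S x K} is an S x K
   matrix whose k-th column is the vector h_k, so that h_{k,i} is [h i k].
   A tensor of R^{S^K} is a finite function on multi-indices; its entries live
   in [R^o], the type R seen as a vector space over itself. *)
Notation multi_index S K := {ffun 'I_K -> 'I_S}.
Notation tensor R S K := {ffun multi_index S K -> R^o}.

Section Norms.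
Variable R : realType.

Definition mx_norm2 m n (X : 'M[R]_(m, n)) : R :=
  Num.sqrt (\sum_(i < m) \sum_(j < n) X i j ^+ 2).

Definition tensor_norm2 S K (T : tensor R S K) : R :=
  Num.sqrt (\sum_(i : multi_index S K) (T i : R) ^+ 2).

Definition tensor_norm_oo S K (T : tensor R S K) : R :=
  \big[Num.max/0]_(i : multi_index S K) `|T i : R|.

End Norms.

Definition Segre (R : realType) S K (h : 'M[R]_(S, K)) : tensor R S K :=
  [ffun i : multi_index S K => \prod_(k < K) h (i k) k].

(* N_0 N_1 ... N_(K-1), of size d 0 x d K; only the dimensions
   d 0, ..., d K matter. *)
Fixpoint chain_mul (R : realType) (d : nat -> nat) (K : nat) :
    (forall k : 'I_K, 'M[R]_(d k, d k.+1)) -> 'M[R]_(d 0%N, d K) :=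
  match K with
  | 0 => fun _ => 1%:M
  | K'.+1 => fun N =>
      chain_mul (fun k : 'I_K' => N (widen_ord (leqnSn K') k)) *m N ord_max
  end.

Section SingularValues.
Variables (R : realType) (S K m n : nat).
Variable A : {linear tensor R S K -> 'M[R]_(m, n)}.

(* The matrix of A in the canonical (orthonormal) bases, acting on row
   vectors; hence the adjoint A^* has matrix [lin_matrix^T] and the
   composite A^* A has matrix [lin_matrix *m lin_matrix^T]. *)
Definition lin_matrix : 'M[R]_(#|{: multi_index S K}|, m * n) :=
  \matrix_i mxvec (A [ffun j => (j == enum_val i)%:R]).

Definition singular_value (s : R) : Prop :=
  0 <= s /\ eigenvalue (lin_matrix *m lin_matrix^T) (s ^+ 2).

(* The set of singular values is finite, and nonempty as soon as S > 0, so its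
   supremum is its largest element. *)
Definition sigma_max : R := sup [set s | singular_value s].

End SingularValues.

Section Metric.
Variables (R : realType) (S K : nat).
Implicit Types h g : 'M[R]_(S, K).

Definition Rstar : set 'M[R]_(S, K) :=
  [set h | forall k : 'I_K, mx_norm2 (col k h) != 0].

Definition rescaling h g : Prop :=
  exists lam : 'I_K -> R,
    \prod_(k < K) lam k = 1 /\ forall k, col k h = lam k *: col k g.

Definition eqclass h : set 'M[R]_(S, K) :=
  [set g | [/\ Rstar h, Rstar g & rescaling g h]].

(* [mx_norm] is the maximum of the absolute values of the entries. *)
Definition Rdiag : set 'M[R]_(S, K) :=
  [set h | Rstar h /\
     forall k l : 'I_K, mx_norm (col k h) = mx_norm (col l h)].

(* The infimum is taken in the extended reals.  It is finite on classes of
   elements of [Rstar]; if h or g is not in [Rstar], where the distance is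
   not defined on paper, the infimum over the empty set is +oo. *)
Definition d2 (H G : set 'M[R]_(S, K)) : \bar R :=
  ereal_inf [set (mx_norm2 (h - g))%:E
            | h in H `&` Rdiag & g in G `&` Rdiag].

End Metric.

Section Properties.
Variables (R : realType) (S K m n : nat).
Variable A : {linear tensor R S K -> 'M[R]_(m, n)}.
Variable Mod : nat -> set 'M[R]_(S, K).

(* [a `^ x] is total with 0 `^ x = 0 for x != 0.  This value is never
   relevant: if one of the two norms vanishes, the distance on the left-hand
   side is +oo. In particular the property entails that every model is
   included in [Rstar], i.e. that all the distances it bounds are defined. *)
Definition stability_property (C delta : R) : Prop :=
  forall (Lbar : nat) (hbar : 'M[R]_(S, K)) (X e : 'M[R]_(m, n)),
    Mod Lbar hbar ->
    X = A (Segre hbar) + e ->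
    mx_norm2 e <= delta ->
  forall (Lstar : nat) (hstar : 'M[R]_(S, K)),
    Mod Lstar hstar ->
    mx_norm2 (A (Segre hstar) - X) ^+ 2 <= mx_norm2 e ->
    (d2 (eqclass hstar) (eqclass hbar) <=
      (C * Num.min (tensor_norm_oo (Segre hbar) `^ (K%:R^-1 - 1))
                   (tensor_norm_oo (Segre hstar) `^ (K%:R^-1 - 1))
         * mx_norm2 e)%:E)%E.

Definition Segre_diff (L L' : nat) : set (tensor R S K) :=
  [set Segre h - Segre g | h in Mod L & g in Mod L'].

Definition deep_NSP (gamma rho : R) : Prop :=
  forall (L L' : nat) (T T' : tensor R S K),
    Segre_diff L L' T ->
    mx_norm2 (A T) <= rho ->
    A T' = 0 ->
    tensor_norm2 T <= gamma * tensor_norm2 (T - T').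

End Properties.

(* Main.v *)
(* Applied to h* = h and error e = A (P h) - A (P g), stability bounds the
   distance between the classes of h and g by |A T|, where T = P h - P g.
   Between representatives with balanced columns, P is Lipschitz with constant
   S^((K-1)/2) sqrt(K) max(|P h|_oo, |P g|_oo)^(1-1/K), so that
   |T| <= C S^((K-1)/2) sqrt(K) |A T|, and A T = A (T - T') is bounded by
   sigma_max |T - T'|.  The last step needs C >= 0; a negative C forces the
   codomain of A to be trivial. *)
Require Import Defs.
From HB Require Import structures.
From mathcomp Require Import all_boot all_order all_algebra.
From mathcomp Require Import all_classical all_reals all_analysis.
From mathcomp Require Import ring lra.

Set Implicit Arguments.
Unset Strict Implicit.
Unset Printing Implicit Defensive.
Import Order.TTheory GRing.Theory Num.Theory numFieldNormedType.Exports.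
Local Open Scope classical_set_scope.
Local Open Scope ring_scope.

(** * Dot product of row vectors and Rayleigh quotient *)

Definition dotrv (R : realType) n (u v : 'rV[R]_n) : R := (u *m v^T) 0 0.

Section DotProduct.
Variables (R : realType) (n : nat).
Implicit Types u v w : 'rV[R]_n.

Lemma dotrvE u v : dotrv u v = \sum_j u 0 j * v 0 j.
Proof. by rewrite /dotrv mxE; apply: eq_bigr => j _; rewrite mxE. Qed.

Lemma dotrvC u v : dotrv u v = dotrv v u.
Proof. by rewrite !dotrvE; apply: eq_bigr => j _; rewrite mulrC. Qed.

Lemma dotrvDl u v w : dotrv (u + v) w = dotrv u w + dotrv v w.
Proof. by rewrite /dotrv mulmxDl mxE. Qed.

Lemma dotrvZl a u w : dotrv (a *: u) w = a * dotrv u w.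
Proof. by rewrite /dotrv -scalemxAl mxE. Qed.

Lemma dotrvDr u v w : dotrv u (v + w) = dotrv u v + dotrv u w.
Proof. by rewrite dotrvC dotrvDl !(dotrvC u). Qed.

Lemma dotrvZr a u w : dotrv u (a *: w) = a * dotrv u w.
Proof. by rewrite dotrvC dotrvZl dotrvC. Qed.

Lemma dotrv_ge0 u : 0 <= dotrv u u.
Proof. by rewrite dotrvE sumr_ge0 // => j _; rewrite -expr2 sqr_ge0. Qed.

Lemma dotrv_eq0 u : (dotrv u u == 0) = (u == 0).
Proof.
apply/eqP/eqP => [|->]; last by rewrite /dotrv mul0mx mxE.
rewrite dotrvE => /eqP; rewrite psumr_eq0 => [/allP u0|j _]; last first.
  by rewrite -expr2 sqr_ge0.
apply/rowP => j; rewrite mxE; apply/eqP.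
by have := u0 j (mem_index_enum _); rewrite /= mulf_eq0 orbb.
Qed.

Lemma continuous_dotrv_mul (M : 'M[R]_n) :
  continuous (fun v : 'rV[R]_n => dotrv (v *m M) v).
Proof.
have -> : (fun v : 'rV[R]_n => dotrv (v *m M) v) =
    (fun v => \sum_i \sum_j (v 0 j * M j i * v 0 i)).
  apply/funext => v; rewrite dotrvE; apply: eq_bigr => i _.
  by rewrite mxE big_distrl.
have add_cont : continuous (fun x : R * R => x.1 + x.2).
  exact: add_continuous.
apply: (continuous_big add_cont) => i _.
apply: (continuous_big add_cont) => j _ v.
have cvc k : (fun w : 'rV[R]_n => w 0 k) @ v --> v 0 k.
  exact: coord_continuous.
exact: cvgM (cvgM (cvc j) (cvg_cst _)) (cvc i).
Qed.

Lemma compact_unit_sphere : compact [set v : 'rV[R]_n | dotrv v v = 1].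
Proof.
apply: bounded_closed_compact.
  exists 1; split; first exact: num_real.
  move=> r r1 v /= v1; rewrite [leLHS]/Num.norm /= mx_normrE.
  apply/bigmax_leP; split=> [|[i j] _ /=]; first by rewrite (le_trans _ (ltW r1)).
  rewrite (le_trans _ (ltW r1)) // -(@ler_pXn2r _ 2) ?nnegrE //.
  rewrite real_normK ?num_real // expr1n -v1 dotrvE (bigD1 j) //= ord1 -expr2.
  by rewrite lerDl sumr_ge0 // => l _; rewrite -expr2 sqr_ge0.
(* The sphere is a level set of the continuous quadratic form of the identity matrix. *)
rewrite [X in closed X](_ : _ =
    (fun v : 'rV[R]_n => dotrv (v *m 1%:M) v) @^-1` [set x | x = 1]); last first.
  by apply/seteqP; split=> v /=; rewrite mulmx1.
apply: preimage_closed; last exact: closed_eq.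
by move=> v _; exact: continuous_dotrv_mul.
Qed.

End DotProduct.

(* The maximiser v of the Rayleigh quotient is an eigenvector: the form
   w |-> lam |w|^2 - <w M, w> is nonnegative and vanishes at v, so its
   differential at v is zero. *)
Lemma max_rayleigh_eigenvector (R : realType) n (M : 'M[R]_n) :
    (0 < n)%N -> M^T = M ->
  exists lam (v : 'rV[R]_n), [/\ v != 0, v *m M = lam *: v &
    forall w : 'rV[R]_n, dotrv (w *m M) w <= lam * dotrv w w].
Proof.
move=> n_gt0 Msym.
have [|v vA vmax] := EVT_max_rV _ (@compact_unit_sphere R n)
    (continuous_subspaceT (@continuous_dotrv_mul R n M)).
  exists (delta_mx 0 (Ordinal n_gt0)); rewrite /= /dotrv trmx_delta.
  by rewrite mul_delta_mx mxE !eqxx.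
have {vA} v1 : dotrv v v = 1 by have := set_mem vA.
pose lam := dotrv (v *m M) v.
have le_lam w : dotrv (w *m M) w <= lam * dotrv w w.
  have [->|w_neq0] := eqVneq w 0.
    by rewrite !mul0mx /dotrv !mul0mx !mxE mulr0.
  have w_gt0 : 0 < dotrv w w by rewrite lt_def dotrv_eq0 w_neq0 dotrv_ge0.
  have s_gt0 : 0 < Num.sqrt (dotrv w w) by rewrite sqrtr_gt0.
  have sE : (Num.sqrt (dotrv w w)) ^+ 2 = dotrv w w by rewrite sqr_sqrtr ?ltW.
  set s := Num.sqrt _ in s_gt0 sE.
  have := vmax (s^-1 *: w); rewrite -scalemxAl !dotrvZl !dotrvZr -sE => le.
  rewrite -ler_pdivrMr ?exprn_gt0 //.
  have := le _; rewrite -/lam => {}le.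
  have -> : dotrv (w *m M) w / s ^+ 2 = s^-1 * (s^-1 * dotrv (w *m M) w).
    by rewrite expr2 invfM mulrC mulrA.
  apply: le; apply/mem_set => /=; rewrite dotrvZl dotrvZr -sE.
  by rewrite expr2; field; rewrite gt_eqF.
exists lam, v; split=> //.
  by rewrite -dotrv_eq0 v1 oner_eq0.
pose z := v *m M - lam *: v.
suff /eqP : dotrv z z = 0 by rewrite dotrv_eq0 subr_eq0 => /eqP.
have dotM u w : dotrv (u *m M) w = dotrv (w *m M) u.
  by rewrite dotrvC /dotrv trmx_mul Msym mulmxA.
set q := dotrv z z.
have zv : dotrv (z *m M) v - lam * dotrv z v = q.
  rewrite dotM /q {3}/z [RHS]dotrvDl -(scaleNr lam v) dotrvZl.
  by rewrite (dotrvC z v) mulNr.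
have q_ge0 : 0 <= q by exact: dotrv_ge0.
pose p := lam * dotrv z z - dotrv (z *m M) z.
have p_ge0 : 0 <= p by rewrite subr_ge0.
(* The nonnegative form at [v + t *: z] equals [- 2 * t * q + t ^+ 2 * p], its value at [v] being
   zero. *)
have key t : 2 * t * q <= t ^+ 2 * p.
  have := le_lam (v + t *: z).
  rewrite mulmxDl -scalemxAl !dotrvDl !dotrvDr !dotrvZl !dotrvZr v1 -/lam.
  rewrite (dotM v z) (dotrvC v z) /p -zv => h; rewrite -subr_ge0.
  move: h; rewrite -subr_ge0; congr (0 <= _); ring.
apply/eqP; rewrite eq_le q_ge0 andbT leNgt; apply/negP => q_gt0.
(* For small positive t the linear term wins. The shift by 1 keeps the denominator positive when [p]
   vanishes. *)
have := key (q / (p + 1)).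
have p1 : 0 < p + 1 by rewrite ltr_wpDl.
rewrite leNgt => /negP; apply.
rewrite -subr_gt0.
have -> : 2 * (q / (p + 1)) * q - (q / (p + 1)) ^+ 2 * p =
  (q / (p + 1)) ^+ 2 * (p + 2) by field; rewrite gt_eqF.
by rewrite mulr_gt0 ?exprn_gt0 ?divr_gt0 // ltr_wpDl.
Qed.

(** * Euclidean norms and the largest singular value *)

Lemma mx_norm2_ge0 (R : realType) m n (X : 'M[R]_(m, n)) : 0 <= mx_norm2 X.
Proof. exact: sqrtr_ge0. Qed.

Lemma tensor_norm2_ge0 (R : realType) S K (T : tensor R S K) :
  0 <= tensor_norm2 T.
Proof. exact: sqrtr_ge0. Qed.

Lemma mx_norm2_sqr (R : realType) m n (X : 'M[R]_(m, n)) :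
  mx_norm2 X ^+ 2 = dotrv (mxvec X) (mxvec X).
Proof.
rewrite sqr_sqrtr; last by do 2!apply: sumr_ge0 => ? _; exact: sqr_ge0.
rewrite dotrvE (reindex _ (curry_mxvec_bij m n)) /= pair_bigA /=.
by apply: eq_bigr => -[i j] _ /=; rewrite mxvecE expr2.
Qed.

Lemma mx_norm2_eq0 (R : realType) m n (X : 'M[R]_(m, n)) :
  (mx_norm2 X == 0) = (X == 0).
Proof.
rewrite -sqrf_eq0 mx_norm2_sqr dotrv_eq0; apply/eqP/eqP => [|->].
  by move/(congr1 vec_mx); rewrite mxvecK linear0.
exact: linear0.
Qed.

Lemma mx_norm2Z (R : realType) m n a (X : 'M[R]_(m, n)) :
  mx_norm2 (a *: X) = `|a| * mx_norm2 X.
Proof.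
apply/eqP; rewrite -(@eqrXn2 _ 2) ?mulr_ge0 ?mx_norm2_ge0 //.
rewrite exprMn !mx_norm2_sqr linearZ dotrvZl dotrvZr mulrA.
by rewrite real_normK ?num_real.
Qed.

Section SigmaMax.
Variables (R : realType) (S K m n : nat).
Variable A : {linear tensor R S K -> 'M[R]_(m, n)}.
Implicit Type T : tensor R S K.

(** Coordinates are ordered by the same enumeration of multi-indices as the rows of [lin_matrix]. *)
Definition tensor_row T : 'rV[R]_(#|{: multi_index S K}|) :=
  \row_i T (enum_val i).

Lemma tensor_norm2_sqr T :
  tensor_norm2 T ^+ 2 = dotrv (tensor_row T) (tensor_row T).
Proof.
rewrite sqr_sqrtr; last by apply: sumr_ge0 => ? _; exact: sqr_ge0.
rewrite dotrvE big_enum_val.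
by apply: eq_bigr => i _; rewrite !mxE expr2.
Qed.

Lemma mxvec_lin_matrix T : mxvec (A T) = tensor_row T *m lin_matrix A.
Proof.
rewrite mulmx_sum_row.
have {1}-> : T = \sum_i (T i : R) *: ([ffun j => (j == i)%:R] : tensor R S K).
  apply/ffunP => j; rewrite sum_ffunE (bigD1 j) //= big1 ?addr0 => [|i /negPf ij].
    by rewrite !ffunE eqxx /GRing.scale /= mulr1.
  by rewrite !ffunE eq_sym ij /GRing.scale /= mulr0.
rewrite !linear_sum big_enum_val; apply: eq_bigr => i _.
by rewrite !linearZ rowK mxE.
Qed.

(** Since S > 0, the matrix [L *m L^T] has positive size and a top eigenvalue [lam] that maximises
    the Rayleigh quotient. Its square root is a singular value and bounds all others, hence is the
    supremum; the Rayleigh inequality reads |A T|^2 <= lam |T|^2. *)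
Lemma sigma_maxP : (0 < S)%N ->
  singular_value A (sigma_max A) /\
  forall T, mx_norm2 (A T) <= sigma_max A * tensor_norm2 T.
Proof.
move=> S_gt0; set L := lin_matrix A.
have dotL w : dotrv (w *m (L *m L^T)) w = dotrv (w *m L) (w *m L).
  by rewrite /dotrv trmx_mul !mulmxA.
have [||lam [v [v_neq0 vL lam_max]]] := @max_rayleigh_eigenvector R _ (L *m L^T).
- by rewrite card_ffun !card_ord expn_gt0 S_gt0.
- by rewrite trmx_mul trmxK.
have dot_gt0 (w : 'rV[R]_#|{: multi_index S K}|) : w != 0 -> 0 < dotrv w w.
  by move=> w0; rewrite lt_def dotrv_eq0 w0 dotrv_ge0.
have lam_ge0 : 0 <= lam.
  rewrite -(pmulr_lge0 _ (dot_gt0 _ v_neq0)) -dotrvZl -vL dotL.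
  exact: dotrv_ge0.
have sv : singular_value A (Num.sqrt lam).
  by split; [exact: sqrtr_ge0|rewrite sqr_sqrtr //; apply/eigenvalueP; exists v].
have ub : ubound [set s | singular_value A s] (Num.sqrt lam).
  move=> s [s_ge0 /eigenvalueP[w wL w0]].
  rewrite -[s]ger0_norm // -sqrtr_sqr ler_wsqrtr //.
  by rewrite -(ler_pM2r (dot_gt0 _ w0)) -dotrvZl -wL.
have -> : sigma_max A = Num.sqrt lam.
  apply/eqP; rewrite eq_le ge_sup //=; last by exists (Num.sqrt lam).
  by apply: ub_le_sup => //; exists (Num.sqrt lam).
split=> // T; rewrite -[leLHS]ger0_norm ?mx_norm2_ge0 // -sqrtr_sqr.
rewrite -(ger0_norm (tensor_norm2_ge0 T)) -sqrtr_sqr -sqrtrM // ler_wsqrtr //.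
by rewrite mx_norm2_sqr mxvec_lin_matrix -dotL tensor_norm2_sqr.
Qed.

Lemma singular_value_codim0 s :
  (forall X : 'M[R]_(m, n), X = 0) -> singular_value A s -> s = 0.
Proof.
move=> all0 [_ /eigenvalueP[v vL v_neq0]].
have : s ^+ 2 *: v = 0.
  rewrite -vL mulmxA -[v *m _]vec_mxK (all0 (vec_mx _)) linear0.
  exact: mul0mx.
by move/eqP; rewrite scaler_eq0 (negPf v_neq0) orbF sqrf_eq0 => /eqP.
Qed.

End SigmaMax.

(** * Lipschitz bound for the Segre map *)

(** Cauchy-Schwarz against the all-ones vector: the right side is the double sum of (x_i^2 + x_j^2)
    / 2, which dominates x_i x_j term by term. *)
Lemma sqr_sum_le (R : realType) n (x : 'I_n -> R) :
  (\sum_i x i) ^+ 2 <= n%:R * \sum_i x i ^+ 2.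
Proof.
have -> : n%:R * \sum_i x i ^+ 2 =
    \sum_(i < n) \sum_(j < n) (x i ^+ 2 + x j ^+ 2) / 2.
  transitivity (\sum_(i < n) (n%:R * x i ^+ 2 / 2 + (\sum_j x j ^+ 2) / 2)).
    rewrite big_split /= sumr_const card_ord -!mulr_suml -mulr_sumr -mulr_natl.
    by field.
  apply: eq_bigr => i _; rewrite -[in RHS]mulr_suml big_split /= sumr_const.
  by rewrite card_ord mulrDl -[_ *+ n in RHS]mulr_natl.
rewrite expr2 big_distrlr /=; apply: ler_sum => i _; apply: ler_sum => j _.
by have := sqr_ge0 (x i - x j); nra.
Qed.

(** Telescoping: the factors are exchanged one at a time, the remaining ones being bounded by
    [m]. *)
Lemma dist_prod_le (R : realType) n (x y : 'I_n -> R) (m : R) :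
    (forall i, `|x i| <= m) -> (forall i, `|y i| <= m) ->
  `|\prod_i x i - \prod_i y i| <= m ^+ n.-1 * \sum_i `|x i - y i|.
Proof.
elim: n x y => [|n IHn] x y xm ym.
  by rewrite !big_ord0 subrr normr0 mulr0.
have m_ge0 : 0 <= m := le_trans (normr_ge0 _) (xm ord0).
rewrite !big_ord_recl /=; set X := \prod_(i < n) _; set Y := \prod_(i < n) _.
have -> : x ord0 * X - y ord0 * Y = (x ord0 - y ord0) * X + y ord0 * (X - Y).
  by ring.
rewrite (le_trans (ler_normD _ _)) // [leRHS]mulrDr !normrM lerD //.
  rewrite mulrC ler_wpM2r // /X normr_prod -[X in m ^+ X]card_ord -prodr_const.
  by apply: ler_prod => i _; rewrite normr_ge0 xm.
have := IHn _ _ (fun i => xm (lift ord0 i)) (fun i => ym (lift ord0 i)).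
(* The induction hypothesis has exponent [n.-1], one below the required [n] only for a nonempty
   tail; for an empty tail [X - Y] is zero. *)
rewrite -/X -/Y; case: n => [|n] /= in IHn x y xm ym X Y *.
  by rewrite !big_ord0 !mulr0 => ?; rewrite mulr_ge0_le0.
move=> le; rewrite exprS -mulrA; exact: ler_pM.
Qed.

(** The summand is a product over the axes with factor 1 off axis [k]; by distributivity each of the
    other K-1 axes contributes S. *)
Lemma sum_ffun_coord (R : realType) S K (k : 'I_K) (F : 'I_S -> R) :
  \sum_(i : multi_index S K) F (i k) = S%:R ^+ K.-1 * \sum_j F j.
Proof.
pose G l j := if l == k then F j else 1.
transitivity (\sum_(i : multi_index S K) \prod_l G l (i l)).
  apply: eq_bigr => i _; rewrite (bigD1 k) //= /G eqxx big1 ?mulr1 // => l.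
  by move=> /negPf->.
rewrite -bigA_distr_bigA (bigD1 k) //= mulrC; congr (_ * _); last first.
  by apply: eq_bigr => j _; rewrite /G eqxx.
under eq_bigr => l /negPf lk do rewrite /G lk sumr_const card_ord.
by rewrite prodr_const cardC1 card_ord.
Qed.

(** After squaring, [dist_prod_le] bounds each entry, [sqr_sum_le] gives the factor K, and S^(K-1)
    counts the multi-indices through a given entry of [h - g]. *)
Lemma Segre_lipschitz (R : realType) S K (h g : 'M[R]_(S, K)) (m : R) :
    (forall i k, `|h i k| <= m) -> (forall i k, `|g i k| <= m) -> 0 <= m ->
  tensor_norm2 (Segre h - Segre g) <=
    Num.sqrt (S%:R ^+ K.-1) * Num.sqrt K%:R * m ^+ K.-1 * mx_norm2 (h - g).
Proof.
move=> hm gm m_ge0; rewrite /tensor_norm2 /mx_norm2.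
rewrite -[m ^+ _]ger0_norm ?exprn_ge0 // -sqrtr_sqr.
rewrite -!sqrtrM ?mulr_ge0 ?exprn_ge0 //.
apply: ler_wsqrtr; rewrite exchange_big /=.
have -> : S%:R ^+ K.-1 * K%:R * (m ^+ K.-1) ^+ 2 *
    (\sum_(k < K) \sum_(j < S) (h - g) j k ^+ 2) =
  \sum_(i : multi_index S K)
    ((m ^+ K.-1) ^+ 2 * (K%:R * \sum_(k < K) `|h (i k) k - g (i k) k| ^+ 2)).
  rewrite -!mulr_sumr [in RHS]exchange_big /=.
  have sum_k k : \sum_(i : multi_index S K) `|h (i k) k - g (i k) k| ^+ 2 =
      S%:R ^+ K.-1 * \sum_j `|h j k - g j k| ^+ 2.
    exact: (sum_ffun_coord k (fun j => `|h j k - g j k| ^+ 2)).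
  under [in RHS]eq_bigr => k _ do rewrite sum_k.
  rewrite -mulr_sumr [RHS]mulrA [RHS]mulrA.
  congr (_ * _); first by ring.
  apply: eq_bigr => k _; apply: eq_bigr => j _.
  by rewrite !mxE real_normK ?num_real.
apply: ler_sum => i _; rewrite !ffunE.
apply: le_trans (ler_wpM2l (sqr_ge0 _) (sqr_sum_le _)).
rewrite -exprMn -[leLHS]real_normK ?num_real // lerXn2r ?nnegrE //.
  by rewrite mulr_ge0 ?exprn_ge0 // sumr_ge0.
exact: dist_prod_le.
Qed.

(** * Balanced representatives and the distance between classes *)

Lemma mx_norm_col_ge (R : realType) S K (h : 'M[R]_(S, K)) i k :
  `|h i k| <= mx_norm (col k h).
Proof.
by rewrite mx_normrE (le_trans _ (le_bigmax _ _ (i, 0))) //= mxE.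
Qed.

Lemma tensor_norm_oo_ge (R : realType) S K (T : tensor R S K) i :
  `|T i : R| <= tensor_norm_oo T.
Proof. exact: (le_bigmax _ (fun j => `|T j : R|)). Qed.

Lemma mx_norm_neq0_of_norm2 (R : realType) m n (X : 'M[R]_(m, n)) :
  mx_norm2 X != 0 -> mx_norm X != 0.
Proof.
apply: contra_neq => /mx_norm_eq0->; rewrite /mx_norm2 big1 ?sqrtr0 // => i _.
by rewrite big1 // => j _; rewrite mxE expr0n.
Qed.

Lemma Rdiag_norm (R : realType) S K (h : 'M[R]_(S, K)) (k : 'I_K) : Rdiag h ->
  0 < mx_norm (col k h) /\
  mx_norm (col k h) ^+ K <= tensor_norm_oo (Segre h).
Proof.
move=> [hs hd]; split.
  by rewrite lt_def mx_norm_neq0_of_norm2 //=; exact: (normr_ge0 (col k h)).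
(* The multi-index [i] picks an entry of largest modulus in every column; as all columns have the
   same norm, the tensor entry at [i] has modulus that norm to the power K. *)
have /choice[i iE] : forall l, exists i : 'I_S, mx_norm (col k h) = `|h i l|.
  move=> l; rewrite (hd k l).
  have [[i j]] := mx_norm_neq0 (mx_norm_neq0_of_norm2 (hs l)).
  by rewrite mxE /= => ->; exists i.
apply: le_trans (tensor_norm_oo_ge _ [ffun l => i l]).
rewrite ffunE normr_prod -[X in _ ^+ X]card_ord -prodr_const le_eqVlt.
by apply/orP; left; apply/eqP/eq_bigr => l _; rewrite ffunE (iE l).
Qed.

Lemma Segre_eqclass (R : realType) S K (h h' : 'M[R]_(S, K)) :
  eqclass h h' -> Segre h' = Segre h.
Proof.
move=> [_ _ [lam [lam1 hE]]]; apply/ffunP => i; rewrite !ffunE.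
transitivity ((\prod_k lam k) * \prod_k h (i k) k); last by rewrite lam1 mul1r.
rewrite -big_split /=; apply: eq_bigr => k _.
by have /colP/(_ (i k)) := hE k; rewrite !mxE.
Qed.

(** Ensures that the powers of exponent 1/K - 1 have a positive base, so that they are positive. *)
Lemma tensor_norm_oo_Segre_gt0 (R : realType) S K (h h' : 'M[R]_(S, K)) :
  (0 < K)%N -> eqclass h h' -> Rdiag h' -> 0 < tensor_norm_oo (Segre h).
Proof.
move=> K_gt0 /Segre_eqclass <- /(Rdiag_norm (Ordinal K_gt0))[c_gt0].
exact/lt_le_trans/exprn_gt0.
Qed.

(** An infimum over the empty set is +oo, so any real bound on the distance provides balanced
    elements on both sides. *)
Lemma d2_fin (R : realType) S K (H G : set 'M[R]_(S, K)) (r : R) :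
  (d2 H G <= r%:E)%E ->
  H `&` Rdiag (K := K) !=set0 /\ G `&` Rdiag (K := K) !=set0.
Proof.
move=> d2r; have [] := pselect
    (H `&` Rdiag (K := K) !=set0 /\ G `&` Rdiag (K := K) !=set0) => // HG.
move: d2r; rewrite /d2 [X in ereal_inf X](_ : _ = set0).
  by rewrite ereal_inf0 leye_eq.
by apply/seteqP; split=> // x [h Hh [g Gg _]]; apply: HG; split;
  [exists h|exists g].
Qed.

Lemma d2_ge0 (R : realType) S K (H G : set 'M[R]_(S, K)) : (0 <= d2 H G)%E.
Proof.
by apply: le_ereal_inf_tmp => _ [h _ [g _ <-]]; rewrite lee_fin mx_norm2_ge0.
Qed.

(** Cancels the weight of the stability bound against the Lipschitz factor: c^(K-1) = (c^K)^(1-1/K)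
    <= u^(1-1/K), the exponent being nonnegative as K >= 1. *)
Lemma powR_le_pred (R : realType) (c u : R) K : (0 < K)%N ->
  0 < c -> c ^+ K <= u -> u `^ (K%:R^-1 - 1) * c ^+ K.-1 <= 1.
Proof.
move=> K_gt0 c_gt0 cu; have u_gt0 : 0 < u := lt_le_trans (exprn_gt0 _ c_gt0) cu.
have K0 : (K%:R : R) != 0 by rewrite pnatr_eq0 -lt0n.
have -> : c ^+ K.-1 = (c ^+ K) `^ (1 - K%:R^-1).
  rewrite -!powR_mulrn ?ltW // -powRrM; congr (_ `^ _).
  by rewrite -subn1 natrB // mulrBr mulr1 mulfV.
have := lexx (1 : R).
rewrite -{1}(powRr0 u) -[X in u `^ X](subrr (K%:R^-1 - 1)).
rewrite powRD; last by rewrite (gt_eqF u_gt0) implybT.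
apply: le_trans; rewrite ler_wpM2l ?powR_ge0 // opprB ge0_ler_powR ?nnegrE //.
- by rewrite subr_ge0 invf_le1 ?ler1n // ltr0n.
- by rewrite exprn_ge0 // ltW.
- exact: ltW.
Qed.

(** The weighted Lipschitz bound holds for every pair of balanced representatives, with the same
    left side since [Segre] is constant on classes; it therefore passes to the infimum. *)
Lemma Segre_d2_le (R : realType) S K (h g : 'M[R]_(S, K)) (r : R) :
    (0 < S)%N -> (0 < K)%N -> (d2 (eqclass h) (eqclass g) <= r%:E)%E ->
  Num.min (tensor_norm_oo (Segre g) `^ (K%:R^-1 - 1))
          (tensor_norm_oo (Segre h) `^ (K%:R^-1 - 1)) *
    tensor_norm2 (Segre h - Segre g) <=
  Num.sqrt (S%:R ^+ K.-1) * Num.sqrt K%:R * r.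
Proof.
move=> S_gt0 K_gt0 d2r; set mu := Num.min _ _; set c := Num.sqrt _ * Num.sqrt _.
have c_gt0 : 0 < c by rewrite mulr_gt0 // sqrtr_gt0 ?exprn_gt0 ?ltr0n.
rewrite -ler_pdivrMl // -lee_fin; apply: le_trans d2r.
apply: le_ereal_inf_tmp => _ [h' [hh' h'd]] [g' [gg' g'd]] <-.
rewrite lee_fin ler_pdivrMl //.
rewrite /mu -(Segre_eqclass hh') -(Segre_eqclass gg').
have [ch_gt0 chK] := Rdiag_norm (Ordinal K_gt0) h'd.
have [cg_gt0 cgK] := Rdiag_norm (Ordinal K_gt0) g'd.
set ch := mx_norm _ in ch_gt0 chK; set cg := mx_norm _ in cg_gt0 cgK.
pose m := Num.max ch cg.
have m_gt0 : 0 < m by rewrite lt_max ch_gt0.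
(* The minimum is at most the weight of whichever tensor has the larger column norm [m], and that
   weight cancels [m ^+ K.-1]. *)
have mu_m : Num.min (tensor_norm_oo (Segre g') `^ (K%:R^-1 - 1))
    (tensor_norm_oo (Segre h') `^ (K%:R^-1 - 1)) * m ^+ K.-1 <= 1.
  rewrite /m; case: (leP ch cg) => _.
  - apply: le_trans (powR_le_pred K_gt0 cg_gt0 cgK).
    by rewrite ler_wpM2r ?ge_min ?lexx // exprn_ge0 // ltW.
  - apply: le_trans (powR_le_pred K_gt0 ch_gt0 chK).
    by rewrite ler_wpM2r ?ge_min ?lexx ?orbT // exprn_ge0 // ltW.
have hm i k : `|h' i k| <= m.
  rewrite le_max (le_trans (mx_norm_col_ge _ _ _)) //.
  by rewrite (proj2 h'd k (Ordinal K_gt0)).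
have gm i k : `|g' i k| <= m.
  rewrite le_max orbC (le_trans (mx_norm_col_ge _ _ _)) //.
  by rewrite (proj2 g'd k (Ordinal K_gt0)).
apply: le_trans (ler_wpM2l _ (Segre_lipschitz hm gm (ltW m_gt0))) _.
  by rewrite le_min !powR_ge0.
have D_ge0 : 0 <= mx_norm2 (h' - g') by exact: sqrtr_ge0.
have := ler_wpM2r (mulr_ge0 (ltW c_gt0) D_ge0) mu_m; rewrite mul1r.
by congr (_ <= _); rewrite -/c; ring.
Qed.

(** * From stability to the deep-null space property *)

(* With a negative constant, admissible nonzero errors e would make the
   distance of a class to itself negative, hence there are none. *)
Lemma stability_property_lt0 (R : realType) S K m n
    (A : {linear tensor R S K -> 'M[R]_(m, n)}) (Mod : nat -> set 'M[R]_(S, K))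
    (C delta : R) L h :
    (0 < K)%N -> 0 < delta -> C < 0 -> Mod L h ->
  stability_property A Mod C delta -> forall X : 'M[R]_(m, n), X = 0.
Proof.
move=> K_gt0 delta_gt0 C_lt0 Lh stab X; apply/eqP/negP => /negP X_neq0.
have X_gt0 : 0 < mx_norm2 X by rewrite lt_def mx_norm2_eq0 X_neq0 mx_norm2_ge0.
(* The bound by [delta] makes [e] admissible; the bound by 1 gives t^2 <= t, the residual condition
   when both parameters are [h]. *)
pose t := Num.min delta 1.
have t_gt0 : 0 < t by rewrite lt_min delta_gt0 ltr01.
pose e := (t / mx_norm2 X) *: X.
have eE : mx_norm2 e = t.
  by rewrite mx_norm2Z ger0_norm ?divr_ge0 ?ltW // divfK ?gt_eqF.
have e_delta : mx_norm2 e <= delta by rewrite eE ge_min lexx.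
have e_sqr : mx_norm2 (A (Segre h) - (A (Segre h) + e)) ^+ 2 <= mx_norm2 e.
  rewrite opprD addNKr -scaleN1r mx_norm2Z normrN1 mul1r eE expr2.
  by rewrite ger_pMl // ge_min lexx orbT.
have d2_le := stab L h _ e Lh erefl e_delta L h Lh e_sqr.
have [[h' [hh' h'd]] _] := d2_fin d2_le.
have u_gt0 := tensor_norm_oo_Segre_gt0 K_gt0 hh' h'd.
have := le_trans (d2_ge0 _ _) d2_le; rewrite lee_fin eE leNgt => /negP; apply.
by rewrite pmulr_llt0 // pmulr_llt0 // lt_min !powR_gt0.
Qed.

Theorem theorem7p3 (R : realType) (K S : nat) (K_ge1 : (1 <= K)%N)
    (S_ge2 : (2 <= S)%N) (d : nat -> nat)
    (M : forall k : 'I_K, {linear 'cV[R]_S -> 'M[R]_(d k, d k.+1)})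
    (A : {linear tensor R S K -> 'M[R]_(d 0%N, d K)})
    (A_spec : forall h : 'M[R]_(S, K),
      chain_mul (fun k : 'I_K => M k (col k h)) = A (Segre h))
    (Mod : nat -> set 'M[R]_(S, K)) (Mod_nonempty : forall L, Mod L !=set0)
    (C delta : R) (delta_gt0 : 0 < delta) :
  stability_property A Mod C delta ->
  deep_NSP A Mod
    (C * S%:R `^ ((K%:R - 1) / 2) * Num.sqrt K%:R * sigma_max A) delta.
Proof.
move=> stab L L' _ T' [h Lh [g L'g <-]] AT_le AT'0.
have S_gt0 : (0 < S)%N by exact: ltnW.
have [sigma_sv A_le] := sigma_maxP A S_gt0.
pose c : R := Num.sqrt (S%:R ^+ K.-1) * Num.sqrt K%:R.
have cE : C * S%:R `^ ((K%:R - 1) / 2) * Num.sqrt K%:R = c * C.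
  have -> : S%:R `^ ((K%:R - 1) / 2) = Num.sqrt (S%:R ^+ K.-1) :> R.
    rewrite powRrM -(natrB _ K_ge1) subn1 powR_mulrn //.
    by rewrite powR12_sqrt ?exprn_ge0.
  by rewrite /c; ring.
have c_ge0 : 0 <= c by rewrite mulr_ge0 // sqrtr_ge0.
rewrite cE -(mulrA c) -(mulrA c) -(mulrA C).
set T := Segre h - Segre g in AT_le *.
set mu := Num.min (tensor_norm_oo (Segre g) `^ (K%:R^-1 - 1))
                  (tensor_norm_oo (Segre h) `^ (K%:R^-1 - 1)).
have d2_le : (d2 (eqclass h) (eqclass g) <= (C * mu * mx_norm2 (A T))%:E)%E.
  (* Stability is used with [g] as the true parameter, [h] as the estimate and [A T] as the error;
     the residual is then zero. *)
  apply: (stab _ _ (A (Segre h)) _ L'g _ AT_le _ _ Lh).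
    by rewrite /T linearB /= addrC subrK.
  rewrite subrr (eqP (_ : mx_norm2 0 == 0)) ?mx_norm2_eq0 //.
  by rewrite expr0n mx_norm2_ge0.
have mu_gt0 : 0 < mu.
  have [[h' [hh' h'd]] [g' [gg' g'd]]] := d2_fin d2_le.
  have := tensor_norm_oo_Segre_gt0 K_ge1 hh' h'd.
  have := tensor_norm_oo_Segre_gt0 K_ge1 gg' g'd.
  by move=> ug uh; rewrite lt_min !powR_gt0.
have T_le : tensor_norm2 T <= c * (C * mx_norm2 (A T)).
  (* The weight [mu] occurs both in the Lipschitz bound and in the stability bound, and cancels. *)
  rewrite -(ler_pM2l mu_gt0); apply: le_trans (Segre_d2_le S_gt0 K_ge1 d2_le) _.
  by rewrite -/c le_eqVlt; apply/orP; left; apply/eqP; ring.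
apply: le_trans T_le _; rewrite ler_wpM2l //.
have [C_ge0|C_lt0] := leP 0 C.
  by rewrite ler_wpM2l // -[A T]subr0 -AT'0 -linearB.
(* For negative C the codomain is trivial, so [sigma_max A] and [A T] are zero and both sides
   vanish. *)
have all0 := stability_property_lt0 K_ge1 delta_gt0 C_lt0 Lh stab.
rewrite (singular_value_codim0 all0 sigma_sv) mul0r.
by rewrite (all0 (A T)) (eqP (_ : mx_norm2 0 == 0)) ?mx_norm2_eq0.
Qed.
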